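(* Let $k$ be an arbitrary field, let $n\geq 1$, and let $p=(p_1,p_2,\ldots,p_r)$ be a partition of $n$. Then there is an affine subspace $A(p)$ of $k^{n\times n}$ of dimension $p_1$ such that the map $A\mapsto R(A)$, sending a matrix to its rational normal form, induces a bijection between $A(p)$ and $R(p)$.
   Context: $k^{n\times n}$ denotes the $k$-vector space of all $n\times n$-matrices over $k$. An affine subspace is a translate $N+L$ of a $k$-linear subspace $L$; its dimension is $\dim_k L$. A partition of $n$ is a sequence of natural numbers $p_1\geq p_2\geq\cdots\geq p_r\geq 1$ with sum $n$. For a monic polynomial $P=a_0+a_1X+\cdots+a_{d-1}X^{d-1}+X^d\in k[X]$ of degree $d\geq 1$, the companion matrix $B(P)\in k^{d\times d}$ has entries $1$ at the positions $(i+1,i)$ for $1\leq i<d$, last column $(-a_0,-a_1,\ldots,-a_{d-1})^T$, and zeros elsewhere (for $d=1$, $B(P)=(-a_0)$). A rational normal form in $k^{n\times n}$ is a block-diagonal matrix $R(P_1,\ldots,P_r)$ with diagonal blocks $B(P_1),\ldots,B(P_r)$ (in this order), where all $P_i\in k[X]$ are monic of degree $\geq 1$ and $P_{i+1}$ divides $P_i$ for $1\leq i\leq r-1$. Each $A\in k^{n\times n}$ is similar over $k$ to exactly one rational normal form, denoted $R(A)$ (classical fact). For a partition $p=(p_1,\ldots,p_r)$ of $n$, $R(p)$ denotes the set of all rational normal forms $R(P_1,\ldots,P_r)$ with blocks of sizes $p_1,\ldots,p_r$, i.e. with $\deg P_i=p_i$ for all $i$. *)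

(* Defs.v *)
From mathcomp Require Import all_boot all_order all_algebra.
From mathcomp Require Import boolp classical_sets functions.

Set Implicit Arguments.
Unset Strict Implicit.
Unset Printing Implicit Defensive.

Import GRing.Theory.

Local Open Scope classical_set_scope.
Local Open Scope ring_scope.

Definition is_partition (n : nat) (p : seq nat) : bool :=
  [&& sorted geq p, all (leq 1) p & sumn p == n].

Definition is_affine_subspace (k : fieldType) (n d : nat)
    (A : set 'M[k]_n) : Prop :=
  exists (N : 'M[k]_n) (L : {vspace 'M[k]_n}),
    \dim L = d /\ A = [set N + v | v in [set` L]].

(* [companionmx P] carries the coefficients in its last row; the normal form
   used here has them in the last column. *)
Definition companion (k : fieldType) (P : {poly k}) : 'M[k]_((size P).-1) :=
  (companionmx P)^T.

Definition invariant_factors (k : fieldType) (Ps : seq {poly k}) : bool :=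
  all (fun P => (P \is monic) && (1 < size P)%N) Ps
  && sorted (fun P Q => Q %| P) Ps.

Definition rnf_dim (k : fieldType) (Ps : seq {poly k}) : nat :=
  (\sum_(i < size Ps) (size (Ps`_i)%R).-1)%N.

Definition rnf_mx (k : fieldType) (Ps : seq {poly k}) : 'M[k]_(rnf_dim Ps) :=
  \mxdiag_(i < size Ps) companion Ps`_i.

(* The equation [e] only transports the block matrix to the index type 'I_n. *)
Definition rnf_with (k : fieldType) (n : nat) (Ps : seq {poly k})
    (B : 'M[k]_n) : Prop :=
  exists e : rnf_dim Ps = n, B = castmx (e, e) (rnf_mx Ps).

Definition is_rnf (k : fieldType) (n : nat) : set 'M[k]_n :=
  [set B | exists2 Ps, invariant_factors Ps & rnf_with Ps B].

Definition rnf_of_shape (k : fieldType) (n : nat) (p : seq nat) :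
    set 'M[k]_n :=
  [set B | exists Ps : seq {poly k},
     [/\ invariant_factors Ps, rnf_with Ps B
       & [seq (size P).-1 | P : {poly k} <- Ps] = p]].

(* The rational normal form similar to A. Every A has exactly one, so [xget]
   always finds it; the default value A would itself not be a rational normal
   form if there were none, similarity being reflexive. *)
Definition rnf (k : fieldType) (n : nat) (A : 'M[k]_n) : 'M[k]_n :=
  xget A [set B | is_rnf B /\ A ~_{in unitmx} B].

(* Main.v *)
Require Import Defs.
From HB Require Import structures.
From mathcomp Require Import all_boot all_order all_algebra.
From mathcomp Require Import boolp classical_sets functions.

(* Write P_i = Q_i Q_(i+1) ... Q_r with Q_i monic of degree p_i - p_(i+1), where
   p_(r+1) = 0 and P_(r+1) = 1.
   The lower coefficients of the Q_i are p_1 free parameters a_0, a_1, ...,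
   where a_(p_(i+1)), ..., a_(p_i - 1) belong to Q_i.  The polynomials
   b_j = X^(j - p_(i+1)) P_(i+1), for p_(i+1) <= j < p_i, together with
   b_(p_1) = P_1, satisfy a recursion
   b_(j+1) = X b_j - sum_(l <= j) H_jl b_l in which each H_jl is 0 or -a_l.
   Hence in the basis b_0, ..., b_(p_i - 1) of k[X]/(P_i), multiplication by X
   is the leading p_i x p_i block of a single matrix depending affinely on a,
   and the block-diagonal matrices with these r blocks form the affine space.
   Uniqueness of the normal form comes from the rank of F(A), which is the sum
   of the deg P_i - deg gcd(P_i, F): at the first place where two normal forms
   differ, taking F = P_i forces the other factor to divide P_i. *)

Set Implicit Arguments.
Unset Strict Implicit.
Unset Printing Implicit Defensive.

Import GRing.Theory.

Local Open Scope ring_scope.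

(** * Polynomials evaluated at block-diagonal and companion matrices *)

Lemma mul_mxdiag (R : pzSemiRingType) (r : nat) (d : 'I_r -> nat)
    (A B : forall i, 'M[R]_(d i)) :
  \mxdiag_i A i *m \mxdiag_i B i = \mxdiag_i (A i *m B i).
Proof.
rewrite {2}/mxdiag mul_mxdiag_mxblock; apply/eq_mxblockP => i j.
case: eqVneq => [ij|_]; last by rewrite mulmx0.
by case: j / ij; rewrite !conform_mx_id.
Qed.

(** The value F(A) by Horner's rule, for matrices of every size, including 0 and sizes such as
    [(size P).-1]. *)
Definition mxhorner (k : fieldType) (n : nat) (A : 'M[k]_n) (F : {poly k}) :
    'M[k]_n :=
  foldr (fun c B => A *m B + c%:M) 0 F.

Section MxHorner.

Variable k : fieldType.

Lemma mxhorner0 n (A : 'M[k]_n) : mxhorner A 0 = 0.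
Proof. by rewrite /mxhorner polyseq0. Qed.

Lemma mxhorner_MXaddC n (A : 'M[k]_n) (F : {poly k}) c :
  mxhorner A (F * 'X + c%:P) = A *m mxhorner A F + c%:M.
Proof.
rewrite -cons_poly_def /mxhorner polyseq_cons; case: nilP => //= F0.
rewrite F0 polyseqC; case: eqVneq => [->|_] /=; rewrite mulmx0 add0r //.
by rewrite raddf0.
Qed.

Lemma mxhorner_intertwine m n (A : 'M[k]_m) (B : 'M[k]_n) (S : 'M[k]_(n, m)) F :
  S *m A = B *m S -> S *m mxhorner A F = mxhorner B F *m S.
Proof.
move=> SA; elim/poly_ind: F => [|F c IH].
  by rewrite !mxhorner0 mulmx0 mul0mx.
by rewrite !mxhorner_MXaddC mulmxDr mulmxDl mulmxA SA -!mulmxA IH scalar_mxC.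
Qed.

Lemma mxhorner_mxdiag r (d : 'I_r -> nat) (A : forall i, 'M[k]_(d i)) F :
  mxhorner (\mxdiag_i A i) F = \mxdiag_i mxhorner (A i) F.
Proof.
elim/poly_ind: F => [|F c IH].
  by rewrite mxhorner0 -mxdiag0; apply: eq_mxdiag => i; rewrite mxhorner0.
rewrite mxhorner_MXaddC IH mul_mxdiag -mxdiagZ -mxdiagD.
by apply: eq_mxdiag => i; rewrite mxhorner_MXaddC.
Qed.

Lemma rank_mxhorner_sim n (A B : 'M[k]_n) F :
  A ~_{in unitmx} B -> \rank (mxhorner A F) = \rank (mxhorner B F).
Proof.
case=> S Su /(simmxP Su)/mxhorner_intertwine-/(_ F) SAB.
rewrite -[RHS](mxrankMfree _ (B := S)) ?row_free_unit // -SAB.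
rewrite -[RHS]mxrank_tr trmx_mul mxrankMfree ?mxrank_tr //.
by rewrite row_free_unit unitmx_tr.
Qed.

(** Row vectors stand for polynomials of degree below deg P; [companionmx P] acts on them from the
    right as multiplication by X on k[X]/(P). *)
Lemma companionmx_mulX (P r : {poly k}) : P \is monic ->
  (size r < size P)%N ->
  poly_rV r *m companionmx P = poly_rV ((r * 'X) %% P) :> 'rV_(size P).-1.
Proof.
move=> Pm sr; have P0 := monic_neq0 Pm.
have szP : size P = (size P).-1.+1 by rewrite polySpred.
set d := (size P).-1 in szP *.
have [d0|d_gt0] := posnP d.
  by apply/rowP => -[j jd]; exfalso; rewrite d0 in jd.
(* As r X has degree at most d and P is monic, subtracting one multiple of P gives the remainder. *)
have -> : (r * 'X) %% P = r * 'X - r`_d.-1 *: P.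
  have sz : (size (r * 'X - r`_d.-1 *: P)%R < size P)%N.
    rewrite szP ltnS; apply/leq_sizeP => j dj; rewrite coefB coefMX coefZ.
    move: dj; rewrite leq_eqVlt => /orP[/eqP <-|dj].
      by rewrite eqn0Ngt d_gt0 -[P`_d]/(lead_coef P) (monicP Pm) mulr1 subrr.
    have j0 : (0 < j)%N by apply: leq_trans dj.
    rewrite eqn0Ngt j0 /= (nth_default _ (s := P)) ?szP // mulr0 subr0.
    by rewrite nth_default // -ltnS prednK // (leq_trans sr) // szP.
  by rewrite -[RHS](modp_small sz) modpD modpN modpZl modpp scaler0 subr0.
apply/rowP => j; rewrite !mxE coefB coefMX coefZ.
have dm : (d.-1 < d)%N by rewrite prednK.
rewrite (bigD1 (Ordinal dm)) //= !mxE /= eqxx mulrN addrC; congr (_ - _).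
have [j0|j_gt0] := posnP j.
  rewrite big1 // => i; rewrite -val_eqE /= => /negPf iN.
  by rewrite !mxE iN j0 /= mulr0.
have jd : (j.-1 < d)%N by rewrite (leq_ltn_trans (leq_pred _)).
have jN : j.-1 != d.-1.
  by rewrite -eqSS !prednK // neq_ltn ltn_ord.
rewrite (bigD1 (Ordinal jd)) //= !mxE /= ifN //.
rewrite prednK // eqxx mulr1 big1 ?addr0 // => i.
rewrite -!val_eqE /= => /andP[/negPf iN /negPf iN'].
rewrite !mxE iN; case: eqP => [ij|]; last by rewrite mulr0.
by rewrite -ij eqxx in iN'.
Qed.

Lemma companionmx_modp (P f : {poly k}) : P \is monic ->
  poly_rV (f %% P) *m companionmx P
    = poly_rV ((f * 'X) %% P) :> 'rV_(size P).-1.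
Proof.
move=> Pm; rewrite companionmx_mulX ?ltn_modpN0 ?monic_neq0 //.
by rewrite mulrC modp_mul mulrC.
Qed.

(** Horner's rule extends the action of X to F, so F(C) is multiplication by F on k[X]/(P). *)
Lemma mxhorner_companionmx (P F f : {poly k}) : P \is monic ->
  poly_rV (f %% P) *m mxhorner (companionmx P) F
    = poly_rV ((f * F) %% P) :> 'rV_(size P).-1.
Proof.
move=> Pm; elim/poly_ind: F f => [|F c IH] f.
  by rewrite mxhorner0 mulmx0 mulr0 mod0p linear0.
rewrite mxhorner_MXaddC mulmxDr mulmxA companionmx_modp // IH.
rewrite mul_mx_scalar -linearZ -linearD /= -modpZl -modpD mulrDr.
by rewrite [F * 'X]mulrC mulrA [f * _%:P]mulrC mul_polyC.
Qed.

Lemma poly_rV_modpK (P : {poly k}) (v : 'rV[k]_(size P).-1) :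
  P != 0 -> poly_rV (rVpoly v %% P) = v.
Proof.
move=> P0; rewrite modp_small ?rVpolyK // (leq_ltn_trans (size_poly _ _)) //.
by rewrite ltn_predL size_poly_gt0.
Qed.

Lemma mxhorner_companionmxM (P F G : {poly k}) : P \is monic ->
  mxhorner (companionmx P) (F * G)
    = mxhorner (companionmx P) F *m mxhorner (companionmx P) G.
Proof.
move=> Pm; apply/row_matrixP => i; rewrite !rowE mulmxA.
have P0 := monic_neq0 Pm.
by rewrite -(poly_rV_modpK (delta_mx 0 i) P0) !mxhorner_companionmx // mulrA.
Qed.

Lemma mxhorner_companionmx_mod (P F : {poly k}) : P \is monic ->
  mxhorner (companionmx P) (F %% P) = mxhorner (companionmx P) F.
Proof.
move=> Pm; apply/row_matrixP => i; rewrite !rowE.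
rewrite -(poly_rV_modpK (delta_mx 0 i) (monic_neq0 Pm)).
by rewrite !mxhorner_companionmx // modp_mul.
Qed.

(** Multiplying polynomials of degree below deg P - deg G by G keeps the degree below deg P, so no
    reduction occurs and the map is injective on them. *)
Lemma rank_mxhorner_companionmx_dvd_ge (P G : {poly k}) : P \is monic ->
  G %| P ->
  ((size P).-1 - (size G).-1 <= \rank (mxhorner (companionmx P) G))%N.
Proof.
move=> Pm GP; have P0 := monic_neq0 Pm.
have G0 : G != 0 by apply: contraNneq P0 => G0; rewrite G0 dvd0p in GP.
set m := (_ - _)%N.
have sP : (size P).-1 = (m + (size G).-1)%N.
  by rewrite subnK // -!subn1 leq_sub2r // dvdp_leq.
pose E : 'M[k]_(m, (size P).-1) := \matrix_i poly_rV 'X^i.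
have EE v : v *m E = poly_rV (rVpoly v %% P).
  have -> : v *m E = poly_rV (rVpoly v).
    rewrite mulmx_sum_row [rVpoly v]poly_def linear_sum; apply: eq_bigr => i _.
    by rewrite rowK valK linearZ.
  rewrite modp_small // (leq_ltn_trans (size_poly _ _)) //.
  by rewrite (leq_ltn_trans (leq_subr _ _)) // ltn_predL size_poly_gt0.
suff /eqP <- : row_free (E *m mxhorner (companionmx P) G).
  exact: mxrankM_maxr.
rewrite -kermx_eq0; apply/rowV0P => v /sub_kermxP.
rewrite mulmxA EE mxhorner_companionmx //.
have sz : (size (rVpoly v * G)%R < size P)%N.
  have [->|v0] := eqVneq (rVpoly v) 0.
    by rewrite mul0r size_poly0 polySpred.
  rewrite size_mul // [size P]polySpred // sP ltnS.
  rewrite [size G]polySpred //= addnS /=.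
  by rewrite leq_add2r size_poly.
rewrite modp_small // => /(congr1 rVpoly).
rewrite poly_rV_K; last by rewrite -ltnS -[X in (_ < X)%N]polySpred.
rewrite linear0 => /eqP; rewrite mulf_eq0 (negPf G0) orbF.
move=> /eqP /(congr1 (@poly_rV _ m)).
by rewrite rVpolyK linear0.
Qed.

(** With P = H G, the relation G(C) H(C) = 0 bounds the sum of both ranks by deg P, and the lower
    bounds for G and H already add up to deg P. *)
Lemma rank_mxhorner_companionmx_dvd (P G : {poly k}) : P \is monic ->
  G %| P ->
  \rank (mxhorner (companionmx P) G) = ((size P).-1 - (size G).-1)%N.
Proof.
move=> Pm GP; have P0 := monic_neq0 Pm.
apply/eqP; rewrite eqn_leq rank_mxhorner_companionmx_dvd_ge // andbT.
have /divpK PE := GP; set H := P %/ G in PE.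
have HP : H %| P by rewrite -PE dvdp_mulr.
have /andP[H0 G0] : (H != 0) && (G != 0) by rewrite -negb_or -mulf_eq0 PE.
have := rank_mxhorner_companionmx_dvd_ge Pm HP.
have -> : ((size P).-1 - (size H).-1 = (size G).-1)%N.
  rewrite -PE size_mul // [size H]polySpred //= [size G]polySpred // addnS /=.
  by rewrite addKn.
have GH0 : mxhorner (companionmx P) G *m mxhorner (companionmx P) H = 0.
  rewrite -mxhorner_companionmxM // mulrC PE -mxhorner_companionmx_mod //.
  by rewrite modpp mxhorner0.
have := mulmx0_rank_max GH0; set a := \rank _; set b := \rank _ => ab gb.
by rewrite -(addnK b a) leq_sub.
Qed.

(** The gcd g divides F, and by Bezout g is a multiple of F modulo P, so F(C) and g(C) have the same
    rank. *)
Lemma rank_mxhorner_companionmx (P F : {poly k}) : P \is monic ->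
  \rank (mxhorner (companionmx P) F)
    = ((size P).-1 - (size (gcdp P F)).-1)%N.
Proof.
move=> Pm; have P0 := monic_neq0 Pm.
rewrite -rank_mxhorner_companionmx_dvd ?dvdp_gcdl //.
apply/eqP; rewrite eqn_leq; apply/andP; split.
  have /divpK FE := dvdp_gcdr P F.
  by rewrite -{1}FE mulrC mxhorner_companionmxM // mxrankM_maxl.
have [[u v]] := Bezoutp P F; rewrite /= eqp_sym => uv.
have /eqpf_eq[c _ gE] := uv.
rewrite -(mxhorner_companionmx_mod (gcdp P F)) // gE modpZl modpD.
rewrite modp_mull add0r -modpZl scalerAl mxhorner_companionmx_mod //.
by rewrite mulrC mxhorner_companionmxM // mxrankM_maxl.
Qed.

End MxHorner.

(** * Uniqueness of the rational normal form *)

Lemma dvdp_rev_trans (k : fieldType) :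
  transitive (fun P Q : {poly k} => Q %| P).
Proof. by move=> Q P R QP RQ; apply: dvdp_trans QP. Qed.

Section Uniqueness.

Variable k : fieldType.

(** For monic P, the rank of multiplication by F on k[X]/(P). *)
Local Notation codeg P F := ((size P).-1 - (size (gcdp P F)).-1)%N.

Lemma invariant_factors_cons (P : {poly k}) Ps : invariant_factors (P :: Ps) ->
  [/\ P \is monic, (1 < size P)%N, invariant_factors Ps
    & {in P :: Ps, forall Q, Q %| P}].
Proof.
rewrite /invariant_factors /= => /andP[/andP[/andP[Pm sP] Psm] Ps_path].
split=> //; first by rewrite Psm (path_sorted Ps_path).
move=> Q; rewrite inE => /predU1P[-> //|].
exact: (allP (order_path_min (@dvdp_rev_trans k) Ps_path)).
Qed.

Lemma invariant_factors_inj (Ps Qs : seq {poly k}) :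
    invariant_factors Ps -> invariant_factors Qs ->
    (forall F, \sum_(P <- Ps) codeg P F = \sum_(Q <- Qs) codeg Q F)%N ->
  Ps = Qs.
Proof.
have codeg1 (P : {poly k}) : codeg P 1 = (size P).-1.
  by rewrite (eqp_size (gcdp1 P)) size_poly1 subn0.
(* F = 1 measures the total degree, which vanishes only for the empty list. *)
have nilE (Rs : seq {poly k}) : invariant_factors Rs ->
    (\sum_(Q <- Rs) codeg Q 1 = 0)%N -> Rs = [::].
  case: Rs => // Q Rs /invariant_factors_cons[_ sQ _ _].
  rewrite big_cons codeg1 => /eqP; rewrite addn_eq0 -subn1 subn_eq0.
  by rewrite leqNgt sQ.
(* F = P annihilates every summand on the left, since all factors there divide P; hence the summand
   of Q vanishes too. *)
have head_dvd (P : {poly k}) Ps' (Q : {poly k}) Qs' :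
    invariant_factors (P :: Ps') -> invariant_factors (Q :: Qs') ->
    (\sum_(P' <- P :: Ps') codeg P' P = \sum_(Q' <- Q :: Qs') codeg Q' P)%N ->
    Q %| P.
  move=> /invariant_factors_cons[_ _ _ dvdP] /invariant_factors_cons[_ sQ _ _].
  rewrite big1_seq; last first.
    move=> P' /= /dvdP /dvdp_gcd_idl /eqp_size ->; exact: subnn.
  move/esym/eqP; rewrite big_cons addn_eq0 => /andP[cod0 _].
  have Q0 : Q != 0 by rewrite -size_poly_gt0 ltnW.
  have : gcdp Q P %= Q.
    rewrite -dvdp_size_eqp ?dvdp_gcdl // eqn_leq leq_gcdpl //=.
    have : gcdp Q P != 0 by rewrite gcdp_eq0 (negPf Q0).
    by move=> /polySpred ->; rewrite [size Q]polySpred // ltnS -subn_eq0.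
  by move=> /eqp_dvdl <-; exact: dvdp_gcdr.
elim: Ps Qs => [|P Ps IH] [|Q Qs] iPs iQs PQ //.
- by rewrite [RHS]nilE // -PQ big_nil.
- by rewrite [LHS]nilE // PQ big_nil.
have PQE : P = Q.
  have [Pm _ _ _] := invariant_factors_cons iPs.
  have [Qm _ _ _] := invariant_factors_cons iQs.
  apply/eqP; rewrite -eqp_monic //; apply/andP; split.
    exact: head_dvd iQs iPs (esym (PQ Q)).
  exact: head_dvd iPs iQs (PQ P).
subst Q; congr (_ :: _); apply: IH => [||F].
- by case: (invariant_factors_cons iPs).
- by case: (invariant_factors_cons iQs).
- by have := PQ F; rewrite !big_cons => /addnI.
Qed.

(** The transpose turns each [companion] back into [companionmx], whose action on rows is known. *)
Lemma rank_mxhorner_rnf (n : nat) (Ps : seq {poly k}) (B : 'M[k]_n) F :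
  invariant_factors Ps -> rnf_with Ps B ->
  \rank (mxhorner B^T F) = (\sum_(P <- Ps) codeg P F)%N.
Proof.
move=> /andP[/allP Psm _] [e ->] {B}; case: n / e.
rewrite castmx_id /rnf_mx tr_mxdiag mxhorner_mxdiag rank_mxdiag.
rewrite (big_nth 0) big_mkord; apply: eq_bigr => i _.
rewrite /companion trmxK rank_mxhorner_companionmx //.
by case/andP: (Psm _ (mem_nth 0 (ltn_ord i))).
Qed.

Lemma simmx_refl (n : nat) (A : 'M[k]_n) : A ~_{in unitmx} A.
Proof.
exists 1%:M; first exact: unitmx1.
by apply/simmxP; [exact: unitmx1|rewrite mul1mx mulmx1].
Qed.

Lemma rnf_with_uniq (n : nat) (Ps Qs : seq {poly k}) (B C : 'M[k]_n) :
    invariant_factors Ps -> invariant_factors Qs ->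
    rnf_with Ps B -> rnf_with Qs C -> B ~_{in unitmx} C ->
  Ps = Qs.
Proof.
move=> iPs iQs PsB QsC [S Su /(simmxP Su) SBC].
apply: invariant_factors_inj => // F.
rewrite -(rank_mxhorner_rnf F iPs PsB) -(rank_mxhorner_rnf F iQs QsC).
(* Transposition reverses the intertwining: S^T conjugates C^T to B^T. *)
apply/esym/rank_mxhorner_sim; exists S^T; first by rewrite unitmx_tr.
by apply/simmxP; rewrite ?unitmx_tr // -!trmx_mul SBC.
Qed.

Lemma rnf_with_inj (n : nat) (Ps : seq {poly k}) (B C : 'M[k]_n) :
  rnf_with Ps B -> rnf_with Ps C -> B = C.
Proof. by move=> [e ->] [e' ->]; rewrite (eq_irrelevance e e'). Qed.

Lemma rnf_unique (n : nat) (Ps : seq {poly k}) (A B : 'M[k]_n) :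
  invariant_factors Ps -> rnf_with Ps B -> A ~_{in unitmx} B -> rnf A = B.
Proof.
move=> iPs PsB AB; rewrite /rnf.
set X := (X in xget A X); have : X (xget A X).
  by apply: xgetPex; exists B; split=> //; exists Ps.
move: (xget A X) => C [[Qs iQs QsC] AC].
suff PsQs : Ps = Qs by apply: rnf_with_inj PsB; rewrite PsQs.
apply: rnf_with_uniq PsB QsC _ => //.
case: AB AC => [S Su /(simmxP Su) SAB] [T Tu /(simmxP Tu) TAC].
(* B and C are compared through A, which S conjugates to B and T to C. *)
exists (T *m invmx S); first by rewrite unitmx_mul Tu unitmx_inv.
apply/simmxP; first by rewrite unitmx_mul Tu unitmx_inv.
have -> : B = S *m A *m invmx S by rewrite SAB mulmxK.
by rewrite -!mulmxA mulKmx // !mulmxA TAC.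
Qed.

End Uniqueness.

(** * From a polynomial recursion to similarity with companion blocks *)

Lemma sim_companion_hessenberg (k : fieldType) (H : nat -> nat -> k)
    (b : nat -> {poly k}) (d : nat) :
    (forall j, b j \is monic /\ size (b j) = j.+1) ->
    (forall j, b j.+1 = b j * 'X - \sum_(l < j.+1) H j l *: b l) ->
  exists e : (size (b d)).-1 = d,
    (\matrix_(i < d, j < d)
       ((i == j.+1 :> nat)%:R + if (i <= j)%N then H j i else 0))
    ~_{in unitmx} castmx (e, e) (companion (b d)).
Proof.
move=> bE bS; have [Pm sP] := bE d.
have e : (size (b d)).-1 = d by rewrite sP.
exists e; move: e Pm sP; move bdP : (b d) => P e Pm _.
case: d / e bdP => bP; rewrite castmx_id /companion.
set M := \matrix_(i, j) _.
have P0 := monic_neq0 Pm.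
have sP : size P = (size P).-1.+1 by rewrite [LHS]polySpred.
(* The b_i form a basis of k[X]/(P) on which multiplication by X is given
   by H; row i of T is b_i in the monomial basis. *)
pose T : 'M[k]_((size P).-1) := \matrix_(i < (size P).-1) poly_rV (b i).
have Tu : T^T \in unitmx.
  rewrite unitmx_tr unitmxE det_trig.
    rewrite big1 ?unitr1 // => i _; rewrite !mxE.
    by have [/monicP <- si] := bE i; rewrite lead_coefE si.
  by apply/is_trig_mxP => i j ij; rewrite !mxE nth_default // (bE i).2.
exists T^T => //; apply/simmxP => //.
apply: trmx_inj; rewrite !trmx_mul !trmxK.
apply/row_matrixP => i; rewrite !row_mul rowK.
rewrite companionmx_mulX //; last by rewrite (bE i).2 -ltn_predRL.
rewrite mulmx_sum_row.
have -> : \sum_j (row i M^T) 0 j *: row j T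
    = poly_rV (\sum_(j < (size P).-1) M j i *: b j).
  by rewrite linear_sum; apply: eq_bigr => j _; rewrite rowK !mxE linearZ.
congr poly_rV; set S := \sum_(j < _) _.
have sS : (size S < size P)%N.
  suff: (size S <= (size P).-1)%N by rewrite -ltnS -sP.
  apply: (leq_trans (size_sum _ _ _)).
  apply/bigmax_leqP => j _; apply: (leq_trans (size_scale_leq _ _)).
  by rewrite (bE j).2.
rewrite -(modp_small sS).
(* Column i of M gives X b_i, except that the last column lacks the term b_d = P, which is zero
   modulo P. *)
suff -> : S = b i * 'X - (i.+1 == (size P).-1)%:R *: P.
  by rewrite modpD modpN modpZl modpp scaler0 subr0.
have -> : S = \sum_(j < (size P).-1) (j == i.+1 :> nat)%:R *: b j
      + \sum_(j < i.+1) H i j *: b j.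
  rewrite (big_ord_widen (size P).-1 (fun j => H i j *: b j)) //.
  rewrite [X in _ + X]big_mkcond /=.
  rewrite -big_split; apply: eq_bigr => j _ /=.
  by rewrite !mxE scalerDl ltnS; case: leqP => // _; rewrite scale0r.
have -> : \sum_(j < i.+1) H i j *: b j = b i * 'X - b i.+1 by rewrite bS subKr.
have [iP|iP] := eqVneq i.+1 (size P).-1.
  rewrite scale1r iP bP big1 ?add0r // => j _.
  by rewrite ltn_eqF ?scale0r.
have iP' : (i.+1 < (size P).-1)%N by rewrite ltn_neqAle iP ltn_ord.
rewrite scale0r subr0 (bigD1 (Ordinal iP')) //= eqxx scale1r big1 ?addr0.
  by rewrite addrC subrK.
by move=> j; rewrite -val_eqE /= => /negPf ->; rewrite scale0r.
Qed.

Lemma rnf_with_mxdiag (k : fieldType) (r : nat) (d : 'I_r -> nat)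
    (A : forall i, 'M[k]_(d i)) (Ps : seq {poly k}) :
    size Ps = r ->
    (forall i : 'I_r, exists e : (size Ps`_i).-1 = d i,
       A i ~_{in unitmx} castmx (e, e) (companion Ps`_i)) ->
  exists2 B, rnf_with Ps B & \mxdiag_i A i ~_{in unitmx} B.
Proof.
move=> er; case: r / er d A => d A AP.
(* Equating the size functions as a whole lets them be substituted, so that all casts become
   trivial. *)
have dE : (fun i : 'I_(size Ps) => (size Ps`_i).-1) = d.
  by apply/funext => i; case: (AP i).
case: d / dE A AP => A AP.
exists (rnf_mx Ps); first by exists erefl; rewrite castmx_id.
(* The boolean form allows [xchoose] to select one conjugating matrix per block. *)
have {}AP i : exists S, (S \in unitmx) && (S *m A i == companion Ps`_i *m S).
  have [e [S Su /(simmxP Su)]] := AP i; rewrite castmx_id => SA.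
  by exists S; rewrite Su SA eqxx.
pose S i := xchoose (AP i).
have SP i : S i \in unitmx /\ S i *m A i = companion Ps`_i *m S i.
  by have /andP[Su /eqP] := xchooseP (AP i).
have Su : \mxdiag_i S i \in unitmx.
  apply: (proj1 (@mulmx1_unit _ _ _ (\mxdiag_i invmx (S i)) _)).
  rewrite mul_mxdiag -mxdiagZ; apply: eq_mxdiag => i.
  by rewrite mulmxV // (SP i).1.
exists (\mxdiag_i S i) => //; apply/simmxP => //.
by rewrite /rnf_mx !mul_mxdiag; apply: eq_mxdiag => i; rewrite (SP i).2.
Qed.

(** * Break points of the partition and the polynomials b_j *)

Section Staircase.

Variables (k : fieldType) (p : seq nat).

(* The largest element of 0 :: p that is at most j. *)
Fixpoint pfloor j :=
  if j is j'.+1 then if j'.+1 \in p then j'.+1 else pfloor j' else 0%N.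

Lemma pfloor_le j : (pfloor j <= j)%N.
Proof. by elim: j => //= j IH; case: ifP => // _; apply: leqW. Qed.

Lemma pfloor_mem j : pfloor j \in 0%N :: p.
Proof. by elim: j => //= j IH; case: ifP => // jp; rewrite inE jp orbT. Qed.

Lemma pfloor_id q : q \in 0%N :: p -> pfloor q = q.
Proof. by case: q => //= q; rewrite inE /= => ->. Qed.

Lemma pfloor_eq j l : (pfloor j <= l <= j)%N -> pfloor l = pfloor j.
Proof.
elim: j => [|j IH] /=; first by rewrite leqn0 => /eqP ->.
case: ifP => [jp /anti_leq <- /=|jp /andP[jl]]; first by rewrite jp.
by rewrite leq_eqVlt => /predU1P[->/=|lj]; rewrite ?jp // IH // jl.
Qed.

Lemma pfloor_max q j : q \in p -> (q <= j)%N -> (q <= pfloor j)%N.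
Proof.
move=> qp; elim: j => [|j IH] /=; first by rewrite leqn0 => /eqP ->.
rewrite leq_eqVlt => /predU1P[<-|]; first by rewrite qp.
by rewrite ltnS => qj; case: ifP => _; [apply: leqW|apply: IH].
Qed.

(** With the existence result that follows, the intervals from [pfloor j] to j with [j.+1] in p
    partition the indices below the largest part, so each a_l belongs to exactly one factor. *)
Lemma pfloor_step_uniq l i j : i.+1 \in p -> (pfloor i <= l <= i)%N ->
  j.+1 \in p -> (pfloor j <= l <= j)%N -> i = j.
Proof.
have W i' j' : i'.+1 \in p -> (l <= i')%N -> (pfloor j' <= l)%N -> (j' <= i')%N.
  move=> ip li jl; rewrite leqNgt; apply/negP => ij.
  by have := leq_trans (pfloor_max ip ij) (leq_trans jl li); rewrite ltnn.
move=> ip /andP[fi li] jp /andP[fj lj]; apply/eqP.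
by rewrite eqn_leq (W j i) // (W i j).
Qed.

Lemma pfloor_step_exists q l : q \in p -> (l < q)%N ->
  exists2 j, j.+1 \in p & (pfloor j <= l <= j)%N.
Proof.
move=> qp lq.
have exq : exists q, (q \in p) && (l < q)%N by exists q; rewrite qp.
(* Take the least part above l; if [pfloor j] exceeded l, it would be a smaller one. *)
case: (ex_minnP exq) => -[|j]; first by rewrite andbF.
move=> /andP[jp lj] jmin.
exists j => //; rewrite -[(l <= j)%N]ltnS lj andbT leqNgt; apply/negP => lf.
have : pfloor j \in p.
  by move: (pfloor_mem j) lf; rewrite inE => /predU1P[->|].
move=> fp; have := jmin (pfloor j); rewrite fp lf => /(_ isT).
by rewrite ltnNge pfloor_le.
Qed.

Variable a : nat -> k.

(** When [j.+1] is in p, this is the factor Q_i of the header with p_i = j + 1 > p_(i+1) =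
    [pfloor j]. *)
Definition step_poly j : {poly k} :=
  'X^(j.+1 - pfloor j) + \poly_(t < j.+1 - pfloor j) a (pfloor j + t).

(** A repeated part contributes one factor only, in accordance with Q_i = 1 for p_i = p_(i+1). *)
Fixpoint pfloor_poly j : {poly k} :=
  if j is j'.+1 then
    if j'.+1 \in p then pfloor_poly j' * step_poly j' else pfloor_poly j'
  else 1.

(* The polynomial b_j of the header; [pfloor_poly j] is b_(pfloor j). *)
Definition stair_poly j : {poly k} := 'X^(j - pfloor j) * pfloor_poly j.

Lemma step_poly_monic j :
  step_poly j \is monic /\ size (step_poly j) = (j.+1 - pfloor j).+1.
Proof.
have sz : (size (\poly_(t < j.+1 - pfloor j) a (pfloor j + t)%N)
           < size ('X^(j.+1 - pfloor j) : {poly k}))%N.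
  by rewrite size_polyXn ltnS size_poly.
rewrite /step_poly monicE lead_coefDl // lead_coefXn size_addl //.
by rewrite size_polyXn.
Qed.

Lemma pfloor_poly_monic j :
  pfloor_poly j \is monic /\ size (pfloor_poly j) = (pfloor j).+1.
Proof.
elim: j => [|j [IHm IHs]] /=; first by rewrite monic1 size_poly1.
case: ifP => _ //; have [Sm Ss] := step_poly_monic j.
rewrite rpredM // size_monicM ?monic_neq0 // IHs Ss addnS addSn /=.
by rewrite subnKC // leqW // pfloor_le.
Qed.

Lemma stair_poly_monic j :
  stair_poly j \is monic /\ size (stair_poly j) = j.+1.
Proof.
have [Fm Fs] := pfloor_poly_monic j.
rewrite /stair_poly rpredM ?monicXn // size_monicM ?monicXn ?monic_neq0 //.
by rewrite size_polyXn Fs addnS addSn /= subnK // pfloor_le.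
Qed.

Lemma pfloor_poly_eq j l : (pfloor j <= l <= j)%N ->
  pfloor_poly l = pfloor_poly j.
Proof.
elim: j => [|j IH] /=; first by rewrite leqn0 => /eqP ->.
case: ifP => [jp /anti_leq <- /=|jp /andP[jl]]; first by rewrite jp.
by rewrite leq_eqVlt => /predU1P[->/=|lj]; rewrite ?jp // IH // jl.
Qed.

Lemma pfloor_poly_dvd i j : (i <= j)%N -> pfloor_poly i %| pfloor_poly j.
Proof.
elim: j => [|j IH]; first by rewrite leqn0 => /eqP ->.
rewrite leq_eqVlt => /predU1P[-> //|ij] /=.
by case: ifP => _; [apply: dvdp_mulr|]; apply: IH.
Qed.

Lemma stair_polyE q : q \in 0%N :: p -> stair_poly q = pfloor_poly q.
Proof. by move=> qp; rewrite /stair_poly pfloor_id // subnn mul1r. Qed.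

Lemma pfloor_polyE j : pfloor_poly j = stair_poly (pfloor j).
Proof.
rewrite stair_polyE ?pfloor_mem //; apply/esym/pfloor_poly_eq.
by rewrite leqnn pfloor_le.
Qed.

(** The H_jl of the header. They vanish unless [j.+1] is a part, since otherwise b_(j+1) = X b_j. *)
Definition stair_coef (j l : nat) : k :=
  if (j.+1 \in p) && (pfloor j <= l)%N then - a l else 0.

(** At a part [j.+1], X b_j is the leading power of Q_i times P_(i+1), and each lower term a_l X^t
    of Q_i, with l = [pfloor j] + t, contributes a_l b_l. *)
Lemma stair_polyS j : stair_poly j.+1
  = stair_poly j * 'X - \sum_(l < j.+1) stair_coef j l *: stair_poly l.
Proof.
have fj := pfloor_le j.
have XE : stair_poly j * 'X = 'X^(j.+1 - pfloor j) * pfloor_poly j.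
  by rewrite /stair_poly mulrAC -exprSr subSn.
rewrite XE /stair_coef /stair_poly /=; case: ifP => jp; last first.
  by rewrite big1 ?subr0 // => l _; rewrite scale0r.
rewrite subnn mul1r /step_poly mulrDr mulrC; congr (_ + _).
rewrite -(big_mkord xpredT (fun l =>
  (if true && (pfloor j <= l)%N then - a l else 0)
    *: ('X^(l - pfloor l) * pfloor_poly l))).
rewrite (big_cat_nat (n := pfloor j)) //=; last exact: leqW.
rewrite big_nat big1 ?add0r; last first.
  by move=> l /andP[_ lf]; rewrite leqNgt lf scale0r.
rewrite -[X in \sum_(X <= _ < _) _]add0n big_addn big_mkord.
rewrite poly_def mulr_sumr -sumrN.
apply: eq_bigr => t _; have tj : (pfloor j <= t + pfloor j <= j)%N.
  by rewrite leq_addl -ltnS; have := ltn_ord t; rewrite ltn_subRL addnC.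
rewrite leq_addl (pfloor_eq tj) (pfloor_poly_eq tj) addnK scaleNr opprK addnC.
by rewrite -scalerAr mulrC.
Qed.

Definition stair_mx d : 'M[k]_d :=
  \matrix_(i < d, j < d)
    ((i == j.+1 :> nat)%:R + if (i <= j)%N then stair_coef j i else 0).

Lemma sim_stair_mx d : exists e : (size (stair_poly d)).-1 = d,
  stair_mx d ~_{in unitmx} castmx (e, e) (companion (stair_poly d)).
Proof.
apply: sim_companion_hessenberg; first exact: stair_poly_monic.
exact: stair_polyS.
Qed.

End Staircase.

(** * Parameters and divisor chains determine each other *)

Section StairBijection.

Variables (k : fieldType) (p : seq nat).

Lemma coef_step_poly (a : nat -> k) j l : (pfloor p j <= l <= j)%N ->
  (step_poly p a j)`_(l - pfloor p j) = a l.
Proof.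
move=> /andP[fl lj]; rewrite /step_poly coefD coefXn coef_poly subnKC //.
have lt : (l - pfloor p j < j.+1 - pfloor p j)%N.
  by rewrite ltn_sub2r ?ltnS // (leq_trans fl).
by rewrite lt ltn_eqF // add0r.
Qed.

(** In the step containing l, cancelling the monic polynomial at the lower end leaves the factor
    that has a_l as a coefficient. *)
Lemma stair_poly_inj (a a' : nat -> k) :
    {in p, forall q, stair_poly p a q = stair_poly p a' q} ->
  forall q l, q \in p -> (l < q)%N -> a l = a' l.
Proof.
move=> aa' q l qp lq.
have {}aa' : {in 0%N :: p, forall q, stair_poly p a q = stair_poly p a' q}.
  by move=> q'; rewrite inE => /predU1P[->|/aa' //]; rewrite !stair_polyE ?inE.
have [j jp jl] := pfloor_step_exists qp lq.
have := aa' j.+1; rewrite inE jp !stair_polyE ?inE ?jp //= => /(_ isT).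
rewrite jp !pfloor_polyE aa' ?pfloor_mem // => /mulfI.
move=> /(_ (monic_neq0 (stair_poly_monic _ _ _).1)) st.
by rewrite -(coef_step_poly a jl) st coef_step_poly.
Qed.

(** Conversely, a chain of monic divisors is rebuilt from the coefficients of its successive
    quotients. *)
Lemma pfloor_poly_of_chain (P : nat -> {poly k}) (a : nat -> k) :
    P 0%N = 1 ->
    {in 0%N :: p, forall q, P q \is monic /\ size (P q) = q.+1} ->
    {in 0%N :: p &, forall q q', (q <= q')%N -> P q %| P q'} ->
    (forall j l, j.+1 \in p -> (pfloor p j <= l <= j)%N ->
       a l = (P j.+1 %/ P (pfloor p j))`_(l - pfloor p j)) ->
  forall j, pfloor_poly p a j = P (pfloor p j).
Proof.
move=> P0 Pmonic Pdvd aE; elim=> [|j IH] //=; case: ifP => // jp; rewrite IH.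
have jp' : j.+1 \in 0%N :: p by rewrite inE jp orbT.
have fp := pfloor_mem p j; have fj := pfloor_le p j.
have [fm fs] := Pmonic _ fp; have [jm js] := Pmonic _ jp'.
have /divpK := Pdvd _ _ fp jp' (leqW fj).
set R := _ %/ _ => RE.
have R_monic : R \is monic by rewrite -(monicMr _ fm) RE.
have Rs : size R = (j.+1 - pfloor p j).+1.
  have := js; rewrite -RE size_monicM ?monic_neq0 // fs addnS /= => Rf.
  by rewrite -addn1 -[LHS](addnK (pfloor p j)) Rf addn1 subSn // leqW.
rewrite -RE mulrC; congr (_ * _); apply/polyP => t.
rewrite /step_poly coefD coefXn coef_poly.
case: (ltngtP t (j.+1 - pfloor p j)) => [tj|tj|->].
- rewrite add0r (aE j) // -?/R ?[(pfloor p j + t)%N]addnC ?addnK //.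
  by rewrite leq_addl -ltnS; move: tj; rewrite ltn_subRL addnC.
- by rewrite addr0 nth_default // Rs.
- rewrite addr0 -[X in R`_X]/((j.+1 - pfloor p j).+1.-1) -Rs -lead_coefE.
  by rewrite (monicP R_monic).
Qed.

End StairBijection.

(** * The affine family of block matrices and its normal forms *)

Section Shape.

Variables (k : fieldType) (p : seq nat).
Hypotheses (p_sorted : sorted geq p) (p_pos : all (leq 1) p).

Let geq_trans : transitive geq.
Proof. by move=> x y z yx xz; apply: leq_trans xz yx. Qed.

Lemma partition_le_head q : q \in p -> (q <= nth 0%N p 0)%N.
Proof.
case: p p_sorted => //= x s /(order_path_min geq_trans)/allP xs.
by rewrite inE => /predU1P[-> //|/xs].
Qed.

Definition stair_seq (a : nat -> k) := [seq stair_poly p a q | q <- p].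

Lemma stair_seq_deg a : [seq (size P).-1 | P : {poly k} <- stair_seq a] = p.
Proof.
rewrite /stair_seq -map_comp -[RHS]map_id; apply: eq_map => q /=.
by rewrite (stair_poly_monic p a q).2.
Qed.

Lemma stair_seq_inv a : invariant_factors (stair_seq a).
Proof.
apply/andP; split.
  apply/allP => _ /mapP[q qp ->]; have [-> ->] := stair_poly_monic p a q.
  by rewrite ltnS; exact: (allP p_pos).
rewrite /stair_seq sorted_map.
apply: (sub_in_sorted (P := mem p)) p_sorted; last exact/allP.
move=> q q' qp q'p /= qq'.
rewrite !stair_polyE ?inE ?[_ \in p]qp ?[_ \in p]q'p ?orbT //.
exact: pfloor_poly_dvd.
Qed.

Lemma stair_seq_surj (Ps : seq {poly k}) : invariant_factors Ps ->
    [seq (size P).-1 | P : {poly k} <- Ps] = p ->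
  exists v : 'rV[k]_(nth 0%N p 0), stair_seq (fun l => (rVpoly v)`_l) = Ps.
Proof.
move=> /andP[/allP Psm Psd] PsE.
have szP : size Ps = size p by rewrite -PsE size_map.
have dvd_refl : reflexive (fun P Q : {poly k} => Q %| P) by exact: dvdpp.
have p0 : 0%N \notin p by apply/negP => /(allP p_pos).
(* As 0 is not a part, its index is out of range and the default 1 yields P 0 = 1. *)
pose P q := nth 1 Ps (index q p).
have P0 : P 0%N = 1 by rewrite /P nth_default // szP leqNgt index_mem.
have idx q : q \in p -> (index q p < size Ps)%N by rewrite szP index_mem.
have Pmonic : {in 0%N :: p, forall q, P q \is monic /\ size (P q) = q.+1}.
  move=> q; rewrite inE => /predU1P[->|qp].
    by rewrite P0 monic1 size_poly1.
  have /andP[Pm _] := Psm _ (mem_nth 1 (idx q qp)).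
  split=> //; rewrite -(prednK (n := size _)) ?size_poly_gt0 ?monic_neq0 //.
  congr _.+1; rewrite -{2}(nth_index 0%N qp) -PsE.
  by rewrite (nth_map 1) ?PsE ?idx.
have Pdvd : {in 0%N :: p &, forall q q', (q <= q')%N -> P q %| P q'}.
  move=> q q'; rewrite inE => /predU1P[->|qp]; first by rewrite P0 dvd1p.
  rewrite inE => /predU1P[->|q'p qq'].
    by rewrite leqn0 => /eqP q0; rewrite q0 (negPf p0) in qp.
  (* If q comes first in the decreasing list p, then q' <= q, hence q = q'. *)
  have [ii|ii] := leqP (index q' p) (index q p).
    apply: (sorted_leq_nth (@dvdp_rev_trans k) dvd_refl 1 Psd) => //.
      by rewrite inE idx.
    by rewrite inE idx.
  have geq_refl : reflexive geq by exact: leqnn.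
  have := sorted_leq_index geq_trans geq_refl p_sorted _ _ qp q'p (ltnW ii).
  by move=> /= q'q; rewrite (@anti_leq q q') ?dvdpp // qq'.
(* Coordinate l is read off the quotient for the unique step containing l. *)
pose v : 'rV[k]_(nth 0%N p 0) := \row_l
  if [pick j : 'I_(nth 0%N p 0) | (j.+1 \in p) && (pfloor p j <= l <= j)%N]
    is Some j then (P j.+1 %/ P (pfloor p j))`_(l - pfloor p j) else 0.
pose a l := (rVpoly v)`_l.
exists v; have vP := pfloor_poly_of_chain P0 Pmonic Pdvd (a := a).
apply: (@eq_from_nth _ 0); rewrite size_map // => i ip.
rewrite (nth_map 0%N) // stair_polyE ?inE ?mem_nth ?orbT // vP; last first.
  move=> j l jp jl; have jh := partition_le_head jp.
  have lh : (l < nth 0%N p 0)%N by case/andP: jl => _ /leq_ltn_trans; apply.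
  rewrite /a -[l]/(nat_of_ord (Ordinal lh)) coef_rVpoly_ord mxE.
  case: pickP => [j' /andP[jp' jl']|/(_ (Ordinal jh))] /=.
    by rewrite (pfloor_step_uniq jp' jl' jp jl).
  by rewrite jp jl.
have ip' := mem_nth 0%N ip.
rewrite pfloor_id ?inE ?ip' ?orbT //.
(* For a repeated part j may precede i; the two factors are still equal, as one divides the other
   and both are monic of the same degree. *)
set j := index (nth 0%N p i) p.
have ji : (j <= i)%N.
  rewrite leqNgt; apply/negP => /(before_find 0%N) /=.
  by rewrite eqxx.
have [Pm Psz] := Pmonic (nth 0%N p i) (mem_behead (s := 0%N :: p) ip').
have /andP[Pim Pis] := Psm _ (mem_nth 0 (leq_trans ip (eq_leq (esym szP)))).
have ips : (i < size Ps)%N by rewrite szP.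
have PiE : Ps`_i = nth 1 Ps i by exact: set_nth_default.
apply/eqP; rewrite eq_sym -eqp_monic // -dvdp_size_eqp.
  rewrite Psz -PsE (nth_map 0) // prednK //.
  by rewrite ltnW.
rewrite PiE; apply: (sorted_leq_nth (@dvdp_rev_trans k) dvd_refl 1 Psd) => //.
by rewrite inE; exact: leq_ltn_trans ips.
Qed.

(** The part of [stair_mx] that is linear in the parameters; [shift_mx] collects the constant
    part. *)
Definition stair_lin (v : 'rV[k]_(nth 0%N p 0)) d : 'M[k]_d :=
  \matrix_(i < d, j < d)
    if (i <= j)%N then stair_coef p (fun l => (rVpoly v)`_l) j i else 0.

Definition stair_diag_lin (v : 'rV[k]_(nth 0%N p 0)) :
    'M[k]_(\sum_(i < size p) nth 0%N p i) :=
  \mxdiag_(i < size p) stair_lin v (nth 0%N p i).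

Lemma stair_diag_lin_is_linear : linear stair_diag_lin.
Proof.
move=> c u v; rewrite -[c *: stair_diag_lin u]mul_scalar_mx.
rewrite -mxdiagZ mul_mxdiag -mxdiagD.
apply: eq_mxdiag => d; rewrite mul_scalar_mx; apply/matrixP => i j.
rewrite !mxE /stair_coef; case: ifP => _; last by rewrite mulr0 addr0.
case: ifP => _; last by rewrite mulr0 addr0.
by rewrite linearP /= coefD coefZ opprD mulrN.
Qed.

HB.instance Definition _ := GRing.isLinear.Build k _ _ _ stair_diag_lin
  stair_diag_lin_is_linear.

Definition shift_mx : 'M[k]_(\sum_(i < size p) nth 0%N p i) :=
  \mxdiag_(i < size p) \matrix_(r < nth 0%N p i, s < nth 0%N p i)
    (r == s.+1 :> nat)%:R.

Lemma stair_mxdiag_sim v : exists2 B,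
  rnf_with (stair_seq (fun l => (rVpoly v)`_l)) B
  & (shift_mx + stair_diag_lin v) ~_{in unitmx} B.
Proof.
have -> : shift_mx + stair_diag_lin v
    = \mxdiag_(i < size p) stair_mx p (fun l => (rVpoly v)`_l) (nth 0%N p i).
  rewrite -mxdiagD; apply: eq_mxdiag => d; apply/matrixP => i j.
  by rewrite !mxE.
apply: rnf_with_mxdiag; first by rewrite size_map.
by move=> i; rewrite (nth_map 0%N) //; exact: sim_stair_mx.
Qed.

Lemma stair_mxdiag_rnf v :
  rnf_with (stair_seq (fun l => (rVpoly v)`_l))
    (rnf (shift_mx + stair_diag_lin v)).
Proof.
have [B PsB AB] := stair_mxdiag_sim v.
by rewrite (rnf_unique (stair_seq_inv _) PsB AB).
Qed.

Lemma stair_mxdiag_rnf_inj :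
  injective (fun v => rnf (shift_mx + stair_diag_lin v)).
Proof.
move=> u v /= uv; have := stair_mxdiag_rnf u; rewrite uv => uP.
have /eq_in_map st := rnf_with_uniq (stair_seq_inv _) (stair_seq_inv _) uP
  (stair_mxdiag_rnf v) (simmx_refl _).
apply/rowP => l; rewrite -!coef_rVpoly_ord.
(* Every coordinate l lies below the largest part, so that part alone reaches all parameters. *)
have hp : nth 0%N p 0 \in p.
  by case: p l {uP st u v uv} => [[]//|x s] _; rewrite mem_head.
exact: stair_poly_inj st _ _ hp (ltn_ord l).
Qed.

End Shape.

Theorem theorem2 (k : fieldType) (n : nat) (n_ge1 : (1 <= n)%N)
    (p : seq nat) (p_partition : is_partition n p) :
  exists A : set 'M[k]_n,
    is_affine_subspace (nth 0%N p 0) A /\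
    set_bij A (@rnf_of_shape k n p) (@rnf k n).
Proof.
case/and3P: p_partition => p_sorted p_pos /eqP pn.
have {n_ge1 pn} nE : (\sum_(i < size p) nth 0%N p i)%N = n.
  by rewrite -pn sumnE (big_nth 0%N) big_mkord.
(* Replacing n by the sum of the block sizes makes the block matrices live in the required space
   without casts. *)
case: n / nE; pose L := linfun (@stair_diag_lin k p).
have LE v : L v = stair_diag_lin v by rewrite lfunE.
have inj := stair_mxdiag_rnf_inj p_sorted p_pos (k := k).
exists [set shift_mx k p + L v | v in setT]%classic; split.
  exists (shift_mx k p), (limg L); split.
    (* If L v = 0, then v and 0 give the same matrix, hence the same normal form, so v = 0; the
       image thus has dimension p_1. *)
    have kerL : (fullv :&: lker L = 0)%VS.
      apply/eqP; rewrite -subv0; apply/subvP => v; rewrite memv_cap memv_ker.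
      move=> /andP[_ /eqP]; rewrite LE => Lv; rewrite memv0; apply/eqP/inj.
      by rewrite /= Lv linear0.
    by rewrite limg_dim_eq // dimvf dim_matrix; exact: mul1n.
  apply/seteqP; split=> [_ [v _ <-]|_ [_ /memv_imgP[v _ ->] <-]].
    by exists (L v) => //; exact: memv_img (memvf v).
  by exists v.
split.
- move=> _ [v _ <-]; exists (stair_seq p (fun l => (rVpoly v)`_l)); split.
  + exact: stair_seq_inv.
  + by rewrite LE; exact: stair_mxdiag_rnf.
  + exact: stair_seq_deg.
- move=> _ _ /set_mem[u _ <-] /set_mem[v _ <-]; rewrite !LE.
  by move=> uv; rewrite (inj u v).
- move=> B [Ps [iPs PsB Psp]].
  have [v vE] := stair_seq_surj p_sorted p_pos iPs Psp.
  exists (shift_mx k p + L v); first by exists v.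
  rewrite LE; apply: rnf_with_inj PsB; rewrite -vE; exact: stair_mxdiag_rnf.
Qed.
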